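(* Let $N\ge1$, let $H\in\mathbb{C}^{N\times N}$ be Hermitian, let $L\in\mathbb{C}^{N\times N}$, and set $J=-iH-\tfrac12 L^\dagger L$. Let $\Delta t>0$, and let $(\mathsf{A},\mathsf{b},\mathsf{c})$ be the Butcher tableau of an $s$-stage explicit Runge-Kutta method, with real entries $a_{ij}$ ($1\le j<i\le s$), $b_i$, $c_i$. Let $U(\tau)=e^{J\tau}$ for $\tau\in\mathbb{R}$. For $\rho_0\in\mathbb{C}^{N\times N}$ define $\rho^{(1)},\ldots,\rho^{(s)}$ and $\rho_1$ by $$\rho^{(i)}=U(c_i\Delta t)\,\rho_0\,U(c_i\Delta t)^\dagger+\Delta t\sum_{j=1}^{i-1}a_{ij}\,U((c_i-c_j)\Delta t)\,L\rho^{(j)}L^\dagger\,U((c_i-c_j)\Delta t)^\dagger,\qquad i=1,\ldots,s,$$ $$\rho_1=U(\Delta t)\,\rho_0\,U(\Delta t)^\dagger+\sum_{i=1}^s b_i\,\Delta t\,U((1-c_i)\Delta t)\,L\rho^{(i)}L^\dagger\,U((1-c_i)\Delta t)^\dagger .$$ If all entries of $\mathsf{A}$ and $\mathsf{b}$ are non-negative, then the map $\rho_0\mapsto\rho_1$ is on Kraus form, and is thus completely positive. The same conclusion holds if the exact flow $U(\tau)=e^{J\tau}$ is replaced throughout by an approximate flow given by matrices $\hat U(\tau)\in\mathbb{C}^{N\times N}$ (for example a truncated Taylor series of $e^{J\tau}$).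
   Context: $\dagger$ denotes the conjugate transpose. A linear map $\mathcal{G}$ on $\mathbb{C}^{N\times N}$ is on Kraus form if there are finitely many matrices $G_l\in\mathbb{C}^{N\times N}$ with $\mathcal{G}\rho=\sum_l G_l^\dagger\rho\,G_l$ for all $\rho$; by Choi's theorem this is equivalent to complete positivity. The scheme is the integrating factor (Lawson) Runge-Kutta discretization of the Lindblad equation $\frac{d}{dt}\rho=-i(H\rho-\rho H)+L\rho L^\dagger-\frac12(L^\dagger L\rho+\rho L^\dagger L)=J\rho+\rho J^\dagger+L\rho L^\dagger$, with time-independent $H$ and $L$. For an explicit Runge-Kutta method, $a_{ij}=0$ for $j\ge i$. *)

(* Defs.v *)
From HB Require Import structures.
From mathcomp Require Import all_boot all_order all_algebra.
From mathcomp Require Import complex.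
From mathcomp Require Import all_classical all_reals all_analysis.
Import numFieldNormedType.Exports.
Set Implicit Arguments.
Unset Strict Implicit.
Unset Printing Implicit Defensive.
Import Order.TTheory GRing.Theory Num.Theory.
Local Open Scope classical_set_scope.
Local Open Scope ring_scope.
Local Open Scope sesquilinear_scope.
Local Open Scope complex_scope.

(* Stated over an abstract numFieldType because this is the type that carries
   the norm topology; it is used below with K := R[i]. *)
Definition expmx (K : numFieldType) (N : nat) (A : 'M[K]_N) : 'M[K]_N :=
  limn (series (fun k : nat => (k`!%:R)^-1 *: A ^+ k)).

Definition kraus_form (R : realType) (N : nat)
    (F : 'M[R[i]]_N -> 'M[R[i]]_N) : Prop :=
  linear F /\
  exists (m : nat) (G : 'I_m -> 'M[R[i]]_N),
    forall rho : 'M[R[i]]_N, F rho = \sum_(l < m) (G l)^t* *m rho *m G l.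

(* In the order of R[i], 0 <= z means that z is real and nonnegative, so this
   forces M to be Hermitian. *)
Definition psdmx (R : realType) (n : nat) (M : 'M[R[i]]_n) : Prop :=
  forall x : 'cV[R[i]]_n, 0 <= (x^t* *m M *m x) 0 0.

(* The map id_k (x) F on k x k block matrices with N x N blocks. *)
Definition amplification (R : realType) (N : nat)
    (F : 'M[R[i]]_N -> 'M[R[i]]_N) (k : nat)
    (X : 'M[R[i]]_(\sum_(i < k) N, \sum_(j < k) N)) :
    'M[R[i]]_(\sum_(i < k) N, \sum_(j < k) N) :=
  \mxblock_(i < k, j < k) F (submxblock X i j).

Definition completely_positive (R : realType) (N : nat)
    (F : 'M[R[i]]_N -> 'M[R[i]]_N) : Prop :=
  linear F /\
  forall (k : nat) (X : 'M[R[i]]_(\sum_(i < k) N)),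
    psdmx X -> psdmx (amplification F X).

Definition lindblad_J (R : realType) (N : nat) (H L : 'M[R[i]]_N) :
    'M[R[i]]_N :=
  - ('i *: H) - (2%:R)^-1 *: (L^t* *m L).

Definition exact_flow (R : realType) (N : nat) (J : 'M[R[i]]_N) (tau : R) :
    'M[R[i]]_N :=
  expmx (tau%:C *: J).

(* The stages satisfy a strong recursion on the stage index: n bounds the
   recursion depth, and n = i.+1 suffices for stage i (lawson_stageE).
   Stages are numbered from 0. *)
Fixpoint lawson_stage_rec (R : realType) (N s : nat) (U : R -> 'M[R[i]]_N)
    (L : 'M[R[i]]_N) (dt : R) (A : 'M[R]_s) (c : 'I_s -> R)
    (rho0 : 'M[R[i]]_N) (n : nat) (i : 'I_s) : 'M[R[i]]_N :=
  if n is n'.+1 then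
    U (c i * dt) *m rho0 *m (U (c i * dt))^t* +
    dt%:C *: \sum_(j < s | (j < i)%N) (A i j)%:C *:
      (U ((c i - c j) * dt) *m
         (L *m lawson_stage_rec U L dt A c rho0 n' j *m L^t*) *m
       (U ((c i - c j) * dt))^t*)
  else 0.

Definition lawson_stage (R : realType) (N s : nat) (U : R -> 'M[R[i]]_N)
    (L : 'M[R[i]]_N) (dt : R) (A : 'M[R]_s) (c : 'I_s -> R)
    (rho0 : 'M[R[i]]_N) (i : 'I_s) : 'M[R[i]]_N :=
  lawson_stage_rec U L dt A c rho0 i.+1 i.

Lemma lawson_stageE (R : realType) (N s : nat) (U : R -> 'M[R[i]]_N)
    (L : 'M[R[i]]_N) (dt : R) (A : 'M[R]_s) (c : 'I_s -> R)
    (rho0 : 'M[R[i]]_N) (i : 'I_s) :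
  lawson_stage U L dt A c rho0 i =
    U (c i * dt) *m rho0 *m (U (c i * dt))^t* +
    dt%:C *: \sum_(j < s | (j < i)%N) (A i j)%:C *:
      (U ((c i - c j) * dt) *m
         (L *m lawson_stage U L dt A c rho0 j *m L^t*) *m
       (U ((c i - c j) * dt))^t*).
Proof.
have depthE n m (j : 'I_s) : (j < n)%N -> (j < m)%N ->
    lawson_stage_rec U L dt A c rho0 n j = lawson_stage_rec U L dt A c rho0 m j.
  elim: n m j => [//|n IHn] [//|m] j jn jm /=; congr (_ + _ *: _).
  apply: eq_bigr => k kj; rewrite (IHn m) //.
  - exact: leq_trans kj jn.
  - exact: leq_trans kj jm.
rewrite {1}/lawson_stage /=; congr (_ + _ *: _).
by apply: eq_bigr => j ji; rewrite (depthE i j.+1).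
Qed.

Definition lawson_step (R : realType) (N s : nat) (U : R -> 'M[R[i]]_N)
    (L : 'M[R[i]]_N) (dt : R) (A : 'M[R]_s) (b c : 'I_s -> R)
    (rho0 : 'M[R[i]]_N) : 'M[R[i]]_N :=
  U dt *m rho0 *m (U dt)^t* +
  \sum_(i < s) (b i * dt)%:C *:
    (U ((1 - c i) * dt) *m
       (L *m lawson_stage U L dt A c rho0 i *m L^t*) *m
     (U ((1 - c i) * dt))^t*).

(* Main.v *)
Require Import Defs.
From HB Require Import structures.
From mathcomp Require Import all_boot all_order all_algebra.
From mathcomp Require Import complex.
From mathcomp Require Import all_classical all_reals all_analysis.
Import numFieldNormedType.Exports.
Set Implicit Arguments.
Unset Strict Implicit.
Unset Printing Implicit Defensive.
Import Order.TTheory GRing.Theory Num.Theory.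
Local Open Scope ring_scope.
Local Open Scope sesquilinear_scope.
Local Open Scope complex_scope.

(** Kraus maps contain the identity and are closed under conjugation
    [F |-> V F V^*], sums and nonnegative multiples (absorb [sqrt a] into the
    Kraus matrices).  When the tableau is nonnegative, the stages and the step
    are built from [rho0] by these operations only.  Complete positivity follows
    since [id_k (x) F] has the block diagonal Kraus matrices
    [diag(G_l, ..., G_l)]. *)

(** Linearity is automatic from the formula, and [enum_val] renumbers the family by an ordinal.
    Arbitrary finite index types let families be empty ([void]) or joined (sum types) without index
    arithmetic. *)
Lemma kraus_form_fin (R : realType) (N : nat) (F : 'M[R[i]]_N -> 'M[R[i]]_N)
    (I : finType) (G : I -> 'M[R[i]]_N) :
  (forall rho, F rho = \sum_l (G l)^t* *m rho *m G l) -> kraus_form F.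
Proof.
move=> FE; split.
  move=> a u v; rewrite !FE scaler_sumr -big_split; apply: eq_bigr => l _ /=.
  by rewrite mulmxDr mulmxDl -scalemxAr -scalemxAl.
exists #|I|, (G \o enum_val) => rho.
rewrite FE (reindex_onto enum_val enum_rank) /= => [|l _].
  by apply: eq_bigl => l; rewrite enum_valK eqxx.
exact: enum_rankK.
Qed.

(** Each Kraus matrix [G l] is replaced by [G l *m V^t*], whose adjoint is [V *m (G l)^t*]. *)
Lemma kraus_form_conj (R : realType) (N : nat) (V : 'M[R[i]]_N)
    (F : 'M[R[i]]_N -> 'M[R[i]]_N) :
  kraus_form F -> kraus_form (fun rho => V *m F rho *m V^t*).
Proof.
move=> [_ [m [G FE]]].
apply: (@kraus_form_fin _ _ _ _ (fun l => G l *m V^t*)) => rho.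
rewrite FE mulmx_sumr mulmx_suml; apply: eq_bigr => l _.
by rewrite trmx_mul map_mxM trmxCK !mulmxA.
Qed.

Lemma kraus_form_id (R : realType) (N : nat) :
  kraus_form (fun rho : 'M[R[i]]_N => rho).
Proof.
apply: (@kraus_form_fin _ _ _ unit (fun=> 1%:M)) => rho.
by rewrite big_const cardT enumT unlock /= addr0 trmx1 map_mx1 mul1mx mulmx1.
Qed.

Lemma kraus_formZ (R : realType) (N : nat) (a : R)
    (F : 'M[R[i]]_N -> 'M[R[i]]_N) :
  0 <= a -> kraus_form F -> kraus_form (fun rho => a%:C *: F rho).
Proof.
move=> a0 [_ [m [G FE]]].
have aC0 : 0 <= a%:C :> R[i] by rewrite ler0c.
apply: (@kraus_form_fin _ _ _ _ (fun l => sqrtC a%:C *: G l)) => rho.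
rewrite FE scaler_sumr; apply: eq_bigr => l _.
rewrite -scalemxAr [(_ *: _)^T]linearZ /= map_mxZ -!scalemxAl scalerA.
(* The root of [a] is real, so conjugation fixes it and the two factors multiply to [a]. *)
by rewrite /= conj_Creal ?ger0_real ?sqrtC_ge0 // -expr2 sqrtCK.
Qed.

Lemma kraus_formD (R : realType) (N : nat) (F1 F2 : 'M[R[i]]_N -> 'M[R[i]]_N) :
  kraus_form F1 -> kraus_form F2 -> kraus_form (fun rho => F1 rho + F2 rho).
Proof.
move=> [_ [m1 [G1 F1E]]] [_ [m2 [G2 F2E]]].
apply: (@kraus_form_fin _ _ _ ('I_m1 + 'I_m2)%type
  (fun l => match l with inl l1 => G1 l1 | inr l2 => G2 l2 end)) => rho.
by rewrite big_sumType F1E F2E.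
Qed.

Lemma kraus_form_sum (R : realType) (N : nat) (I : Type) (r : seq I)
    (P : pred I) (F : I -> 'M[R[i]]_N -> 'M[R[i]]_N) :
  (forall i, P i -> kraus_form (F i)) ->
  kraus_form (fun rho => \sum_(i <- r | P i) F i rho).
Proof.
move=> krF; elim: r => [|i r IHr].
  apply: (@kraus_form_fin _ _ _ void (fun=> 0)) => rho.
  by rewrite big_nil big1 // => -[].
under eq_fun do rewrite big_cons; case Pi: (P i) => //.
by apply: kraus_formD => //; apply: krF.
Qed.

(** The quadratic form of the conjugated matrix at [x] is that of [M] at [B *m x]. *)
Lemma psdmx_conj (R : realType) (m n : nat) (M : 'M[R[i]]_m)
    (B : 'M[R[i]]_(m, n)) :
  psdmx M -> psdmx (B^t* *m M *m B).
Proof.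
by move=> psdM x; have := psdM (B *m x); rewrite trmx_mul map_mxM !mulmxA.
Qed.

Lemma kraus_form_completely_positive (R : realType) (N : nat)
    (F : 'M[R[i]]_N -> 'M[R[i]]_N) :
  kraus_form F -> completely_positive F.
Proof.
move=> [linF [m [G FE]]]; split=> // k X psdX.
have -> : amplification F X =
    \sum_l (\mxdiag_(i < k) G l)^t* *m X *m (\mxdiag_(i < k) G l).
  rewrite /amplification; under eq_mxblock do rewrite FE.
  rewrite mxblock_sum; apply: eq_bigr => l _.
  have -> : (\mxdiag_(i < k) G l)^t* = \mxdiag_(i < k) (G l)^t*.
    rewrite tr_mxdiag; apply/matrixP => i j; rewrite !mxE.
    (* All blocks have size [N], so the cast inside [mxdiag] is the identity on the diagonal; off
       it, conjugation fixes zero. *)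
    by case: eqVneq => _; rewrite ?conform_mx_id !mxE ?rmorph0.
  (* With [X] cut into its blocks, block diagonal factors on both sides act on each block
     separately. *)
  by rewrite -{2}(submxblockK X) mul_mxdiag_mxblock mul_mxblock_mxdiag.
move=> x; rewrite mulmx_sumr mulmx_suml summxE.
by apply: sumr_ge0 => l _; apply: psdmx_conj.
Qed.

Lemma kraus_form_lawson_stage (R : realType) (N s : nat)
    (U : R -> 'M[R[i]]_N) (L : 'M[R[i]]_N) (dt : R) (A : 'M[R]_s)
    (c : 'I_s -> R) (i : 'I_s) :
  0 <= dt -> (forall i j, 0 <= A i j) ->
  kraus_form (fun rho0 => lawson_stage U L dt A c rho0 i).
Proof.
(* Strong induction on the stage index, as stage [i] involves every earlier stage. *)
move=> dt0 A0; have [n] := ubnP (i : nat).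
elim: n i => // n IHn i; rewrite ltnS => lein.
under eq_fun do rewrite lawson_stageE.
apply: kraus_formD; first exact/kraus_form_conj/kraus_form_id.
apply: kraus_formZ => //; apply: kraus_form_sum => j ltji.
(* The inner conjugation is by [L], the outer one by the flow. *)
apply: kraus_formZ => //; do 2!apply: kraus_form_conj.
exact/IHn/(leq_trans ltji).
Qed.

Lemma kraus_form_lawson_step (R : realType) (N s : nat)
    (U : R -> 'M[R[i]]_N) (L : 'M[R[i]]_N) (dt : R) (A : 'M[R]_s)
    (b c : 'I_s -> R) :
  0 <= dt -> (forall i j, 0 <= A i j) -> (forall i, 0 <= b i) ->
  kraus_form (lawson_step U L dt A b c).
Proof.
move=> dt0 A0 b0; apply: kraus_formD; first exact/kraus_form_conj/kraus_form_id.
apply: kraus_form_sum => i _; apply: kraus_formZ; first exact: mulr_ge0.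
by do 2!apply: kraus_form_conj; apply: kraus_form_lawson_stage.
Qed.

Theorem mainTheorem2 (R : realType) (N : nat) (hN : (1 <= N)%N)
    (H L : 'M[R[i]]_N) (hH : H \is hermsymmx)
    (dt : R) (hdt : 0 < dt)
    (s : nat) (A : 'M[R]_s) (b c : 'I_s -> R)
    (hexplicit : forall i j : 'I_s, (i <= j)%N -> A i j = 0)
    (hA : forall i j : 'I_s, 0 <= A i j)
    (hb : forall i : 'I_s, 0 <= b i) :
  (let U := exact_flow (lindblad_J H L) in
   kraus_form (lawson_step U L dt A b c) /\
   completely_positive (lawson_step U L dt A b c)) /\
  (forall Uhat : R -> 'M[R[i]]_N,
   kraus_form (lawson_step Uhat L dt A b c) /\
   completely_positive (lawson_step Uhat L dt A b c)).
Proof.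
(* The flow enters only through conjugations, so one statement for all [U] covers both the exact and
   the approximate flow. *)
have kr U := kraus_form_lawson_step U L c (ltW hdt) hA hb.
by split=> [|Uhat]; split=> //; apply: kraus_form_completely_positive.
Qed.
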